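(* Writing $B_k^{nb}:=B_k^{neobc}$ and $C_k^{nb}:=C_k^{neobc}$, the balancing numbers $B_n$, cobalancing numbers $b_n$, Lucas-balancing numbers $C_n$ and Lucas-cobalancing numbers $c_n$ satisfy: $$B_n=\frac16\begin{cases}4B^{nb}_{\frac{n+1}{2}}-C^{nb}_{\frac{n+1}{2}}-3 & n\geq1 \text{ odd},\\ 20B^{nb}_{\frac{n+2}{2}}-7C^{nb}_{\frac{n+2}{2}}-15 & n\geq2\text{ even},\end{cases}$$ $$b_n=\frac1{12}\begin{cases}-16B^{nb}_{\frac{n+1}{2}}+6C^{nb}_{\frac{n+1}{2}}+6 & n\geq1 \text{ odd},\\ 20B^{nb}_{\frac{n+2}{2}}-4B^{nb}_{\frac{n}{2}}-7C^{nb}_{\frac{n+2}{2}}+C^{nb}_{\frac{n}{2}}-18 & n\geq2\text{ even},\end{cases}$$ $$C_n=\frac16\begin{cases}-8B^{nb}_{\frac{n+1}{2}}+4C^{nb}_{\frac{n+1}{2}}+6 & n\geq1 \text{ odd},\\ 60B^{nb}_{\frac{n+2}{2}}-4B^{nb}_{\frac{n}{2}}-21C^{nb}_{\frac{n+2}{2}}+C^{nb}_{\frac{n}{2}}-42 & n\geq2\text{ even},\end{cases}$$ $$c_n=\frac16\begin{cases}24B^{nb}_{\frac{n+1}{2}}-8C^{nb}_{\frac{n+1}{2}}-18 & n\geq1 \text{ odd},\\ 20B^{nb}_{\frac{n+2}{2}}+4B^{nb}_{\frac{n}{2}}-7C^{nb}_{\frac{n+2}{2}}-C^{nb}_{\frac{n}{2}}-18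 & n\geq2\text{ even}.\end{cases}$$
   Context: Let $\alpha=1+\sqrt2$, $\beta=1-\sqrt2$. For $n\ge1$: balancing numbers $B_n=\frac{\alpha^{2n}-\beta^{2n}}{4\sqrt2}$; cobalancing numbers $b_n=\frac{\alpha^{2n-1}-\beta^{2n-1}}{4\sqrt2}-\frac12$ (so $b_1=0,b_2=2,b_3=14$); Lucas-balancing numbers $C_n=\frac{\alpha^{2n}+\beta^{2n}}{2}=\sqrt{8B_n^2+1}$; Lucas-cobalancing numbers $c_n=\frac{\alpha^{2n-1}+\beta^{2n-1}}{2}=\sqrt{8b_n^2+8b_n+1}$. A positive integer $m$ is a neo balcobalancing number if there is a positive integer $r$ such that $(1+2+\cdots+(m-1))+(1+2+\cdots+m)=2[(m-1)+m+(m+1)+(m+2)+\cdots+(m+r)]$ (equivalently, $8m^2-12m+9$ is a perfect square). $B_k^{neobc}$ is the $k$-th neo balcobalancing number in increasing order ($k\ge1$) and $C_k^{neobc}=\sqrt{8(B_k^{neobc})^2-12B_k^{neobc}+9}$. *)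

(* Defs.v *)
From HB Require Import structures.
From mathcomp Require Import all_boot all_order all_algebra.
From mathcomp Require Import boolp classical_sets reals.

Set Implicit Arguments.
Unset Strict Implicit.
Unset Printing Implicit Defensive.

Import Order.TTheory GRing.Theory Num.Theory.

Local Open Scope ring_scope.

Definition alpha (R : realType) : R := 1 + Num.sqrt 2.
Definition beta (R : realType) : R := 1 - Num.sqrt 2.

(* The four sequences below are meant for n >= 1; the exponent 2 * n - 1 is a
   truncated subtraction only at n = 0. *)
Definition balancing (R : realType) (n : nat) : R :=
  (alpha R ^+ (2 * n) - beta R ^+ (2 * n)) / (4 * Num.sqrt 2).

Definition cobalancing (R : realType) (n : nat) : R :=
  (alpha R ^+ (2 * n - 1) - beta R ^+ (2 * n - 1)) / (4 * Num.sqrt 2) - 1 / 2.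

Definition lucas_balancing (R : realType) (n : nat) : R :=
  (alpha R ^+ (2 * n) + beta R ^+ (2 * n)) / 2.

Definition lucas_cobalancing (R : realType) (n : nat) : R :=
  (alpha R ^+ (2 * n - 1) + beta R ^+ (2 * n - 1)) / 2.

Definition neo_balcobalancing (m : nat) : Prop :=
  (0 < m)%N /\
  exists r : nat, (0 < r)%N /\
    (\sum_(1 <= i < m) i + \sum_(1 <= i < m.+1) i
     = 2 * \sum_(m - 1 <= i < (m + r).+1) i)%N.

(* [Bneobc k] is the k-th neo balcobalancing number in increasing order, for
   k >= 1: the least one exceeding [Bneobc (k - 1)]. The value [Bneobc 0 = 0]
   only starts the recursion. If no such number existed, [xget] would return
   the junk value 0. *)
Fixpoint Bneobc (k : nat) : nat :=
  if k is k'.+1 then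
    xget 0%N (fun m : nat =>
      [/\ neo_balcobalancing m, (Bneobc k' < m)%N &
          forall j : nat, neo_balcobalancing j -> (Bneobc k' < j)%N ->
            (m <= j)%N])
  else 0%N.

Definition Cneobc (R : realType) (k : nat) : R :=
  Num.sqrt (8 * (Bneobc k)%:R ^+ 2 - 12 * (Bneobc k)%:R + 9).

(* Main.v *)
(** The defining equation [m ^ 2 = 2 ((m - 1) + m + ... + (m + r))] amounts to
    [c ^ 2 = 8 m ^ 2 - 12 m + 9] for [c = 2 (m + r) + 1], that is, to the Pell
    equation [(4 m - 3) ^ 2 - 2 c ^ 2 = - 9].
    Multiplication of [4 m - 3 + c sqrt 2] by the inverse of
    [17 + 12 sqrt 2 = alpha ^ 4] maps every solution with [6 <= m] to a smaller
    one, and the only solution with [m < 6] is [(0, 3)]. So the pairs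
    [(Bneobc k, Cneobc k)] are exactly the iterates of multiplication by
    [alpha ^ 4] on [(0, 3)], which gives their Binet forms in [alpha ^ (4 k)]
    and [beta ^ (4 k)]. The eight formulas are then polynomial identities modulo
    [(sqrt 2) ^ 2 = 2]. *)
Require Import Defs.
From HB Require Import structures.
From mathcomp Require Import all_boot all_order all_algebra.
From mathcomp Require Import boolp classical_sets reals.
From mathcomp Require Import zify ring.

Set Implicit Arguments.
Unset Strict Implicit.
Unset Printing Implicit Defensive.

Import Order.TTheory GRing.Theory Num.Theory.

Local Open Scope ring_scope.

(** Gauss summation, doubled and with [d] moved to the left so that neither division nor truncated
    subtraction occurs. *)
Lemma sum_nat_interval (a d : nat) :
  (2 * \sum_(a <= i < a + d) i + d = d * (2 * a + d))%N.
Proof.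
elim: d => [|d IHd]; first by rewrite big_geq ?addn0.
rewrite (addnS a) big_nat_recr ?leq_addr //=; nia.
Qed.

Lemma neo_sumE (m r : nat) : (0 < m)%N ->
  (\sum_(1 <= i < m) i + \sum_(1 <= i < m.+1) i
     = 2 * \sum_(m - 1 <= i < (m + r).+1) i)%N <->
  ((2 * (m + r) + 1) ^ 2 + 12 * m = 8 * m ^ 2 + 9)%N.
Proof.
case: m => // m _.
have := sum_nat_interval 1 m; have := sum_nat_interval 1 m.+1.
have := sum_nat_interval m (r + 2).
rewrite subn1 /= !add1n (_ : (m.+1 + r).+1 = m + (r + 2))%N; last by lia.
move: (\sum_(_ <= i < m.+1) i) (\sum_(_ <= i < m.+2) i) => p q.
move: (\sum_(_ <= i < _) i) => t; rewrite -!mulnn; split; nia.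
Qed.

(** The negative term is moved across to avoid truncated subtraction. The pair [(0, 3)] is allowed
    and serves as seed. *)
Definition neo_sol (p : nat * nat) : Prop :=
  (p.2 ^ 2 + 12 * p.1 = 8 * p.1 ^ 2 + 9)%N.

Lemma neo_sol_small (m c : nat) : neo_sol (m, c) -> (m < 6)%N -> (m, c) = (0, 3)%N.
Proof.
rewrite /neo_sol /= -!mulnn.
case: m => [|[|[|[|[|[|//]]]]]] h _.
- by congr (_, _); nia.
(* For [m] from 1 to 5 the required square is 5, 17, 45, 89, 149, each strictly between consecutive
   squares. *)
- by exfalso; have [|] := leqP c 2; nia.
- by exfalso; have [|] := leqP c 4; nia.
- by exfalso; have [|] := leqP c 6; nia.
- by exfalso; have [|] := leqP c 9; nia.
- by exfalso; have [|] := leqP c 12; nia.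
Qed.

Lemma neo_balcobalancingE (m : nat) :
  neo_balcobalancing m <-> (0 < m)%N /\ exists c, neo_sol (m, c).
Proof.
split=> [[m0 [r [r0 /(neo_sumE _ m0) h]]]|[m0 [c h]]].
  by split=> //; exists (2 * (m + r) + 1)%N.
split=> //.
have m6 : (6 <= m)%N.
  by rewrite leqNgt; apply/negP => /(neo_sol_small h) [m00 _]; rewrite m00 in m0.
(* Here [c ^ 2 - (2 m + 3) ^ 2 = 4 m (m - 6)]. The bound makes [r = (c - 1) / 2 - m] positive. *)
have cge : (2 * m + 3 <= c)%N by move: h; rewrite /neo_sol /= -!mulnn; nia.
have codd : odd c.
  have : odd (c ^ 2 + 12 * m) by rewrite h oddD oddM.
  by rewrite oddD oddM addbF oddX.
have cE := odd_double_half c; rewrite codd in cE.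
exists (c./2 - m)%N; split; first by lia.
apply/(neo_sumE _ m0); rewrite (_ : 2 * (m + (c./2 - m)) + 1 = c)%N //; lia.
Qed.

(* Multiplication of [4 m - 3 + c sqrt 2] by [17 + 12 sqrt 2]. *)
Definition neo_next (p : nat * nat) : nat * nat :=
  (17 * p.1 + 6 * p.2 - 12, 48 * p.1 + 17 * p.2 - 36)%N.

Definition neo_seq (k : nat) : nat * nat := iter k neo_next (0, 3)%N.

(** The bound by 3 keeps both subtractions in [neo_next] from truncating. *)
Lemma neo_seq_inv (k : nat) : (3 <= (neo_seq k).2)%N /\ neo_sol (neo_seq k).
Proof.
elim: k => [//|k]; rewrite /neo_seq /= -/(neo_seq k).
case: (neo_seq k) => m c; rewrite /neo_sol /neo_next /= -!mulnn => -[c3 h].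
split; nia.
Qed.

Lemma neo_seqS_lt (k : nat) : ((neo_seq k).1 < (neo_seq k.+1).1)%N.
Proof.
have [] := neo_seq_inv k; rewrite /neo_seq /= -/(neo_seq k).
by case: (neo_seq k) => m c /=; lia.
Qed.

Lemma neo_seq_lt : {mono (fun k => (neo_seq k).1) : i j / (i < j)%N}.
Proof.
apply: leqW_mono; apply: leq_mono.
apply: (homo_ltn (r := fun m n => m < n)%N) => [? ? ?|];
  by [exact: ltn_trans | exact: neo_seqS_lt].
Qed.

Lemma neo_sol_descent (m c : nat) : neo_sol (m, c) -> (6 <= m)%N ->
  exists p, [/\ neo_sol p, (p.1 < m)%N & neo_next p = (m, c)].
Proof.
rewrite /neo_sol /= -!mulnn => h m6.
(* After squaring, this is [(m - 6) (m + 30) >= 0], whence the threshold 6. [h1] and [h2] make the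
   witness, the product with [17 - 12 sqrt 2], free of truncation; [h3] makes it smaller. *)
have h1 : (6 * c + 12 <= 17 * m)%N by nia.
have h2 : (48 * m <= 17 * c + 36)%N by nia.
have h3 : (16 * m < 6 * c + 12)%N by nia.
exists (17 * m - 6 * c - 12, 17 * c + 36 - 48 * m)%N.
rewrite /neo_next /=; split; [|lia|congr (_, _); lia].
move: (subnKC h2); have : (17 * m = (17 * m - 6 * c - 12) + (6 * c + 12))%N by lia.
by move: (_ - 12)%N (_ - 48 * m)%N => x y; rewrite -!mulnn; nia.
Qed.

Lemma neo_sol_in_seq (m c : nat) : neo_sol (m, c) -> exists k, neo_seq k = (m, c).
Proof.
elim/ltn_ind: m c => m IHm c h.
have [/(neo_sol_small h) ->|m6] := ltnP m 6; first by exists 0%N.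
have [[m' c'] [h' /= lt_m' <-]] := neo_sol_descent h m6.
by have [k <-] := IHm _ lt_m' _ h'; exists k.+1.
Qed.

Lemma neo_seq_balcobalancing (k : nat) : neo_balcobalancing (neo_seq k.+1).1.
Proof.
apply/neo_balcobalancingE; split.
  exact: leq_ltn_trans (neo_seqS_lt k).
by have [_] := neo_seq_inv k.+1; case: (neo_seq _) => m c; exists c.
Qed.

(** The seed matches [Bneobc 0 = 0]. Every neo balcobalancing number is a term of the strictly
    increasing [neo_seq], so the next term is the unique value [xget] can pick, never its
    default. *)
Lemma BneobcE (k : nat) : Bneobc k = (neo_seq k).1.
Proof.
elim: k => [//|k IHk] /=; rewrite IHk.
have least j : neo_balcobalancing j -> ((neo_seq k).1 < j)%N ->
    ((neo_seq k.+1).1 <= j)%N.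
  move=> /neo_balcobalancingE [_ [c /neo_sol_in_seq [i iE]]].
  have <- : (neo_seq i).1 = j by rewrite iE.
  rewrite neo_seq_lt => lt_ki.
  by rewrite leqNgt neo_seq_lt -leqNgt.
apply: xget_unique.
  by split; [exact: neo_seq_balcobalancing | exact: neo_seqS_lt | exact: least].
move=> m [neo_m lt_m le_m]; apply/eqP; rewrite eqn_leq least // andbT.
by apply: le_m; [exact: neo_seq_balcobalancing | exact: neo_seqS_lt].
Qed.

Lemma sqrt2_sqr (R : realType) : Num.sqrt 2 ^+ 2 = 2 :> R.
Proof. by rewrite sqr_sqrtr. Qed.

Lemma sqrt2V (R : realType) : (Num.sqrt 2)^-1 = Num.sqrt 2 / 2 :> R.
Proof.
have s0 : Num.sqrt 2 != 0 :> R by rewrite gt_eqF // sqrtr_gt0.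
by apply: (mulfI s0); rewrite divff // mulrA -expr2 sqrt2_sqr divff ?pnatr_eq0.
Qed.

Lemma CneobcE (R : realType) (k : nat) : Cneobc R k = (neo_seq k).2%:R.
Proof.
rewrite /Cneobc BneobcE; have [_] := neo_seq_inv k.
case: (neo_seq k) => m c h.
have /= hR : (c ^ 2 + 12 * m)%:R = (8 * m ^ 2 + 9)%:R :> R by congr (_%:R).
rewrite !(natrD, natrX, natrM) in hR.
rewrite (_ : _ + 9 = c%:R ^+ 2) ?sqrtr_sqr ?ger0_norm ?ler0n //.
by rewrite addrAC -hR addrK.
Qed.

(** At the seed, [4 m - 3 + c s] is [3 (s - 1)] and its conjugate is [- 3 (s + 1)]. Each step
    multiplies them by [alpha ^ 4] and [beta ^ 4]; half the sum and half the difference give [m] and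
    [c]. *)
Lemma neo_seq_binet (R : realType) (k : nat) (s := Num.sqrt 2 : R) :
  (neo_seq k).1%:R = 3 / 4 + 3 / 8 * (alpha R ^+ (4 * k) * (s - 1)
                                      - beta R ^+ (4 * k) * (s + 1)) /\
  (neo_seq k).2%:R = 3 / 4 * s * (alpha R ^+ (4 * k) * (s - 1)
                                  + beta R ^+ (4 * k) * (s + 1)).
Proof.
have s2 : s ^+ 2 = 2 := sqrt2_sqr R.
elim: k => [|k]; first by rewrite muln0 !expr0 /=; split; [field | field: s2].
have [c3 _] := neo_seq_inv k.
rewrite mulnS !exprD /neo_seq /= -/(neo_seq k) /alpha /beta -/s.
move: c3; case: (neo_seq k) => m c /= c3 [hm hc].
rewrite !natrB ?natrD ?natrM; [|lia|lia].
rewrite hm hc; move: ((1 + s) ^+ (4 * k)) ((1 - s) ^+ (4 * k)) => a b.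
by split; field: s2.
Qed.

Theorem theorem4p1 (R : realType) (n : nat) (hn : (1 <= n)%N) :
  let Bnb := fun k : nat => (Bneobc k)%:R : R in
  let Cnb := fun k : nat => Cneobc R k in
  [/\ balancing R n =
        1 / 6 *
        (if odd n
         then 4 * Bnb ((n + 1) %/ 2)%N - Cnb ((n + 1) %/ 2)%N - 3
         else 20 * Bnb ((n + 2) %/ 2)%N - 7 * Cnb ((n + 2) %/ 2)%N - 15),
      cobalancing R n =
        1 / 12 *
        (if odd n
         then - 16 * Bnb ((n + 1) %/ 2)%N + 6 * Cnb ((n + 1) %/ 2)%N + 6
         else 20 * Bnb ((n + 2) %/ 2)%N - 4 * Bnb (n %/ 2)%N
              - 7 * Cnb ((n + 2) %/ 2)%N + Cnb (n %/ 2)%N - 18),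
      lucas_balancing R n =
        1 / 6 *
        (if odd n
         then - 8 * Bnb ((n + 1) %/ 2)%N + 4 * Cnb ((n + 1) %/ 2)%N + 6
         else 60 * Bnb ((n + 2) %/ 2)%N - 4 * Bnb (n %/ 2)%N
              - 21 * Cnb ((n + 2) %/ 2)%N + Cnb (n %/ 2)%N - 42) &
      lucas_cobalancing R n =
        1 / 6 *
        (if odd n
         then 24 * Bnb ((n + 1) %/ 2)%N - 8 * Cnb ((n + 1) %/ 2)%N - 18
         else 20 * Bnb ((n + 2) %/ 2)%N + 4 * Bnb (n %/ 2)%N
              - 7 * Cnb ((n + 2) %/ 2)%N - Cnb (n %/ 2)%N - 18)].
Proof.
move=> Bnb Cnb; rewrite {}/Bnb {}/Cnb !CneobcE !BneobcE.
(* Trading the inverse of [sqrt 2] for [sqrt 2 / 2] leaves identities polynomial in [sqrt 2]. *)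
rewrite /balancing /cobalancing /lucas_balancing /lucas_cobalancing invfM sqrt2V.
have s2 := sqrt2_sqr R.
have [n_odd|n_even] := boolP (odd n).
  have [k ->] : exists k, n = (2 * k + 1)%N by exists n./2; lia.
  rewrite (_ : (2 * k + 1 + 1) %/ 2 = k.+1)%N; last by lia.
  rewrite (_ : 2 * (2 * k + 1) - 1 = 4 * k + 1)%N; last by lia.
  rewrite (_ : 2 * (2 * k + 1) = 4 * k + 2)%N; last by lia.
  have [-> ->] := neo_seq_binet R k.+1.
  rewrite mulnS addnC (addnC 2%N) !exprD /alpha /beta.
  move: (Num.sqrt 2) s2 => s s2.
  by split; field: s2.
(* Writing [n] as [2 k + 2] rather than [2 k] turns the exponent [2 n - 1] into [4 k + 3], with no
   subtraction left. *)
have [k ->] : exists k, n = (2 * k + 2)%N by exists (n./2 - 1)%N; lia.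
rewrite (_ : (2 * k + 2 + 2) %/ 2 = k.+2)%N; last by lia.
rewrite (_ : (2 * k + 2) %/ 2 = k.+1)%N; last by lia.
rewrite (_ : 2 * (2 * k + 2) - 1 = 4 * k + 3)%N; last by lia.
rewrite (_ : 2 * (2 * k + 2) = 4 * k + 4)%N; last by lia.
have [-> ->] := neo_seq_binet R k.+1; have [-> ->] := neo_seq_binet R k.+2.
rewrite !mulnS !exprD /alpha /beta.
move: (Num.sqrt 2) s2 => s s2.
by split; field: s2.
Qed.
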